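(* For any fixed real number $\epsilon>0$, there exists a positive integer $k_0$ depending on $\epsilon$ such that \[ \chi(K^2(2k+1,k))\le (2+\epsilon)\bigl(k+\sqrt{2k+1}\bigr) \] for every positive integer $k\ge k_0$. Thus, for any fixed real number $\epsilon>0$, \[ \limsup_{k\to\infty}\frac{\chi(K^2(2k+1,k))}{k}\le 2+\epsilon. \]
   Context: For integers $m\ge 2k$, the Kneser graph $K(m,k)$ is the graph whose vertices are the $k$-element subsets of a fixed $m$-element set, two vertices $A,B$ being adjacent if and only if $A\cap B=\emptyset$. The square $G^2$ of a simple graph $G$ has vertex set $V(G)$, and two distinct vertices are adjacent in $G^2$ if and only if their distance in $G$ is at most $2$. $K^2(m,k)$ denotes the square of $K(m,k)$, and $\chi$ denotes the chromatic number. *)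

(* Defs.v *)
From mathcomp Require Import all_boot.

Set Implicit Arguments.
Unset Strict Implicit.
Unset Printing Implicit Defensive.

Record sgraph := SGraph {
  vertex :> finType;
  adj : rel vertex;
  adj_sym : symmetric adj;
  adj_irr : irreflexive adj }.

Definition walk (G : sgraph) (n : nat) (x y : G) : bool :=
  [exists p : n.-tuple G, path (@adj G) x p && (last x p == y)].

(* A shortest walk repeats no vertex, so it has fewer than #|G| edges and the
   search may stop there; None stands for infinite distance. *)
Definition gdist (G : sgraph) (x y : G) : option nat :=
  let n := find (fun n => walk n x y) (iota 0 #|G|) in
  if n < #|G| then Some n else None.

Lemma walkP (G : sgraph) (n : nat) (x y : G) :
  reflect (exists p : seq G, [/\ path (@adj G) x p, last x p = y & size p = n])
          (walk n x y).
Proof.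
apply: (iffP existsP) => [[p /andP[xp /eqP py]]|[p [xp py /eqP sp]]].
  by exists p; rewrite size_tuple.
by exists (Tuple sp); rewrite xp py /=.
Qed.

Lemma gdist_leP (G : sgraph) (x y : G) (d : nat) :
  reflect (exists2 n, n <= d & walk n x y)
          (if gdist x y is Some n then n <= d else false).
Proof.
rewrite /gdist; set a := fun n => walk n x y.
have shrt n : walk n x y -> exists2 m, m < #|G| & (m <= n) && walk m x y.
  case/walkP=> p [xp py <-]; case/shortenP: xp py => q xq uq sub qy.
  exists (size q); first by have := card_uniqP uq => /= <-; apply: max_card.
  apply/andP; split; last by apply/walkP; exists q.
  by apply: uniq_leq_size => //; case/andP: uq.
case: ltnP => [lt|ge]; apply: (iffP idP) => //.
- move=> le; exists (find a (iota 0 #|G|)) => //.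
  have h : has a (iota 0 #|G|) by rewrite has_find size_iota.
  by have := nth_find 0 h; rewrite nth_iota.
- case=> n le /shrt[m ltm /andP[mn wm]].
  apply: leq_trans (leq_trans mn le); rewrite leqNgt; apply/negP => lt'.
  by have := before_find 0 lt'; rewrite nth_iota // /a wm.
case=> n _ /shrt[m ltm /andP[_ wm]].
have : has a (iota 0 #|G|) by apply/hasP; exists m; rewrite ?mem_iota.
by rewrite has_find size_iota ltnNge ge.
Qed.

Lemma walk_sym (G : sgraph) (n : nat) : symmetric (@walk G n).
Proof.
suff sub (x y : G) : walk n x y -> walk n y x by move=> x y; apply/idP/idP => /sub.
case/walkP=> p [xp <- <-]; apply/walkP; exists (rev (belast x p)); split.
- by rewrite rev_path (eq_path (e' := @adj G)) // => u v; rewrite adj_sym.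
- by case: (p) => //= z q; rewrite rev_cons last_rcons.
- by rewrite size_rev size_belast.
Qed.

Definition square_adj (G : sgraph) (x y : G) : bool :=
  (x != y) && (if gdist x y is Some d then d <= 2 else false).

Lemma square_adj_sym (G : sgraph) : symmetric (@square_adj G).
Proof.
move=> x y; rewrite /square_adj eq_sym; congr (_ && _).
by apply/gdist_leP/gdist_leP => -[n le w]; exists n => //; rewrite walk_sym.
Qed.

Lemma square_adj_irr (G : sgraph) : irreflexive (@square_adj G).
Proof. by move=> x; rewrite /square_adj eqxx. Qed.

Definition square (G : sgraph) : sgraph :=
  SGraph (@square_adj_sym G) (@square_adj_irr G).

Definition colorable (G : sgraph) (n : nat) : bool :=
  [exists f : {ffun G -> 'I_n}, forall x, forall y, adj x y ==> (f x != f y)].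

Lemma colorable_card (G : sgraph) : exists n, colorable G n.
Proof.
exists #|G|; apply/existsP; exists [ffun x => enum_rank x].
apply/'forall_forallP => x y; apply/implyP => xy; rewrite !ffunE.
by apply: contraTneq xy => /enum_rank_inj ->; rewrite adj_irr.
Qed.

Definition chi (G : sgraph) : nat := ex_minn (colorable_card G).

Definition kvertex (m k : nat) : finType := {A : {set 'I_m} | #|A| == k}.

(* The condition A != B only matters for k = 0, where the empty set would
   otherwise be adjacent to itself. *)
Definition kneser_adj (m k : nat) (A B : kvertex m k) : bool :=
  (A != B) && (val A :&: val B == set0).

Lemma kneser_adj_sym (m k : nat) : symmetric (@kneser_adj m k).
Proof. by move=> A B; rewrite /kneser_adj eq_sym setIC. Qed.

Lemma kneser_adj_irr (m k : nat) : irreflexive (@kneser_adj m k).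
Proof. by move=> A; rewrite /kneser_adj eqxx. Qed.

Definition kneser (m k : nat) : sgraph :=
  SGraph (@kneser_adj_sym m k) (@kneser_adj_irr m k).

(* Main.v *)
Require Import Defs.
From mathcomp Require Import all_boot all_order all_algebra.
From mathcomp Require Import all_classical all_reals all_analysis.
From mathcomp Require Import zify lra.

Import Order.TTheory GRing.Theory Num.Theory.
Local Open Scope ring_scope.

(** Label the [n = 2k+1] points injectively by [(f1 i, f2 i)] in an abelian
    group [V * W], where [V = F_2^t], every [f1 i] is nonzero and the [f1 i]
    add up to [0]. Colour a [k]-set by the sum of its labels. Two [k]-sets at
    distance 2 differ by exchanging one point, so injectivity separates them.
    Two disjoint [k]-sets cover all points but one, [c], so their [V]-sums add
    up to [f1 c <> 0], and these sums differ because [V] has exponent 2.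
    As only the zero of [V] is wasted, [#|V| * #|W|] can be taken to be
    [2^t * (n / (2^t - 1) + 2)], and [t] is as large as we please. *)

Lemma chi_le_card (G : sgraph) (T : finType) (f : G -> T) :
  (forall x y, adj x y -> f x != f y) -> (chi G <= #|T|)%N.
Proof.
move=> fP; rewrite /chi; case: ex_minnP => m _; apply.
apply/existsP; exists [ffun x => enum_rank (f x)].
apply/forallP => x; apply/forallP => y; apply/implyP => /fP.
by rewrite !ffunE; apply: contra_neq => /enum_rank_inj.
Qed.

Lemma square_adjP (G : sgraph) (x y : G) :
  @adj (square G) x y -> adj x y \/ exists2 z, adj x z & adj z y.
Proof.
case/andP => xy /gdist_leP[n le2 /walkP[p [xp py sp]]].
case: p xp py sp => [|z [|u [|v p]]] /=.
- by move=> _ eqxy; rewrite eqxy eqxx in xy.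
- by rewrite andbT => xz <-; left.
- by rewrite andbT => /andP[xz zu] <- _; right; exists z.
- by move=> _ _ sp; rewrite -sp in le2.
Qed.

(** Outside [C] there remain [k + 1] of the [2 * k + 1] points, one more than [A] takes up. This
    serves both for adjacent sets and for sets with a common neighbour. *)
Lemma kneser_adj_setC (k : nat) (A C : kneser (2 * k + 1) k) :
  adj A C -> exists2 a, a \notin val A & ~: val C = a |: val A.
Proof.
case/andP => _ AC0; have AC : val A \subset ~: val C.
  by rewrite -finset.disjoints_subset -finset.setI_eq0.
have cA := eqP (valP A); have cC := eqP (valP C).
have /eqP/cards1P[a aP] : #|~: val C :\: val A| = 1%N.
  rewrite cardsD (finset.setIidPr AC) cardsCs finset.setCK card_ord; lia.
have : a \in ~: val C :\: val A by rewrite aP set11.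
rewrite inE => /andP[aA _]; exists a => //.
rewrite -(finset.setID (~: val C) (val A)) (finset.setIidPr AC) aP.
exact: finset.setUC.
Qed.

Lemma chi_square_kneser_le (V W : finZmodType) (k : nat)
    (f : 'I_(2 * k + 1) -> V * W) :
  (forall x : V, x + x = 0) -> injective f ->
  (forall i, (f i).1 != 0) -> \sum_i (f i).1 = 0 ->
  (chi (square (kneser (2 * k + 1) k)) <= #|V| * #|W|)%N.
Proof.
move=> V2 finj f0 fsum; rewrite -card_prod.
pose c (A : kneser (2 * k + 1) k) := \sum_(i in val A) f i.
apply: (@chi_le_card (square _) _ c) => A B adjAB.
have neqAB : A != B by case/andP: adjAB.
apply/eqP => cAB; case: (square_adjP _ _ _ adjAB) => [|[C AC CB]].
  case/kneser_adj_setC => a aA CB; move/eqP: (f0 a); apply.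
  have sumf : \sum_i f i = c A + f a + c B.
    by rewrite (bigID [in ~: val B]) /= CB big_setU1 //= [f a + _]addrC;
      congr (_ + _); apply: eq_bigl => i; rewrite -CB inE negbK.
  have := congr1 fst sumf; rewrite raddf_sum /= fsum cAB.
  by rewrite addrAC V2 add0r.
(* With a common neighbour [C], both [A] and [B] arise from [~: val C] by deleting one point; equal
   colours force the deleted points to have equal labels. *)
rewrite adj_sym in CB.
have [a aA Ca] := kneser_adj_setC _ _ _ AC.
have [b bB Cb] := kneser_adj_setC _ _ _ CB.
have sumC : f a + c A = f b + c B by rewrite -!big_setU1 // -Ca -Cb.
have ab : a = b by apply: finj; move: sumC; rewrite cAB => /addIr.
case/eqP: neqAB; apply: val_inj.
by rewrite -(finset.setU1K aA) -Ca Cb -ab finset.setU1K // ab.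
Qed.

(** Labels with both components nonzero are handed out first. If their first components add up to
    [s != 0], one label is corrected by [- s]; the reserved second component [0] keeps it distinct
    from all others. *)
Lemma labelling_exists (V : finZmodType) (m n : nat) :
  (n <= #|V|.-1 * m)%N -> (m.+1 < n)%N ->
  exists f : 'I_n -> V * 'I_m.+1,
    [/\ injective f, forall i, (f i).1 != 0 & \sum_i (f i).1 = 0].
Proof.
move=> len ltn.
pose D := finset.setX [set~ (0 : V)] [set~ (0 : 'I_m.+1)].
have cD : #|D| = (#|V|.-1 * m)%N by rewrite cardsX !cardsC1 card_ord.
rewrite -cD in len.
pose g i : V * 'I_m.+1 := enum_val (widen_ord len i).
have ginj : injective g.
  by move=> i j /enum_val_inj/(congr1 val)/= ij; apply: val_inj.
have gD i : ((g i).1 != 0) && ((g i).2 != 0).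
  by have := enum_valP (widen_ord len i); rewrite !inE.
pose s := \sum_i (g i).1.
have [s0|s0] := eqVneq s 0.
  by exists g; split=> // i; case/andP: (gD i).
(* The corrected component [(g i0).1 - s] must stay nonzero. If every first component were [s], the
   second ones would embed [n] points into [m.+1] values. *)
have [i0 gi0] : exists i, (g i).1 != s.
  apply/existsP; rewrite -negb_forall; apply/negP => /forallP gs.
  have /leq_card : injective (fun i => (g i).2).
    move=> i j ij; apply: ginj; rewrite [g i]surjective_pairing ij.
    by rewrite (eqP (gs i)) -(eqP (gs j)) -surjective_pairing.
  by rewrite !card_ord leqNgt ltn.
pose f i := if i == i0 then ((g i0).1 - s, 0 : 'I_m.+1) else g i.
exists f; split.
- move=> i j; rewrite /f; case: eqP => [->|_]; case: eqP => [->|_] //.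
  + by move=> /(congr1 snd)/= g20; case/andP: (gD j); rewrite -g20 eqxx.
  + by move=> /(congr1 snd)/= g20; case/andP: (gD i); rewrite g20 eqxx.
  + exact: ginj.
- move=> i; rewrite /f; case: (i =P i0) => _ /=; first by rewrite subr_eq0.
  by case/andP: (gD i).
- rewrite (bigD1 i0) //= /f eqxx /=.
  rewrite (eq_bigr (fun i => (g i).1)); last by move=> i /negPf ->.
  by rewrite addrAC -(bigD1 i0 (P := predT) (F := fun i => (g i).1)) // subrr.
Qed.

(** Take [V] to be the row vectors over ['F_2] and [W] to be ['I_m.+1]. Of the summand [2], one unit
    rounds the quotient up and the other pays for the reserved zero of [W]. *)
Lemma chi_square_kneser_pow2 (t k : nat) : (1 < t)%N -> (1 < k)%N ->
  (chi (square (kneser (2 * k + 1) k))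
     <= 2 ^ t * ((2 * k + 1) %/ (2 ^ t).-1 + 2))%N.
Proof.
move=> t1 k1; set N := (2 ^ t).-1; set m := ((2 * k + 1) %/ N).+1.
have N3 : (3 <= N)%N.
  by rewrite /N -ltnS prednK ?expn_gt0 // (@leq_exp2l 2 2).
have cV : #|{: 'rV['F_2]_t}| = (2 ^ t)%N by rewrite card_mx card_Fp // mul1n.
have lenm : (2 * k + 1 <= #|{: 'rV['F_2]_t}|.-1 * m)%N.
  by rewrite cV -/N [leqRHS]mulnC ltnW // ltn_ceil // (leq_trans _ N3).
have ltmn : (m.+1 < 2 * k + 1)%N.
  have := leq_div2l (2 * k + 1) (isT : (0 < 3)%N) N3; rewrite /m; lia.
have [f [finj f0 fsum]] := labelling_exists _ _ _ lenm ltmn.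
have V2 (x : 'rV['F_2]_t) : x + x = 0.
  by apply/rowP => i; rewrite !mxE; apply: addrr_pchar2; apply: pchar_Fp.
have := chi_square_kneser_le _ _ _ f V2 finj f0 fsum.
by rewrite cV card_ord /m addn2.
Qed.

(** With [q] the quotient, [(N + 1) * (q + 2)] is at most [2 * k + q + (2 * N + 3)], since
    [q * N <= 2 * k + 1]. The choice of [t] bounds [q] by [eps * k / 2], and then the choice of [b]
    does the same for [2 * N + 3]. *)
Lemma chi_square_kneser_asymp (R : realType) (eps : R) : 0 < eps ->
  exists2 k0 : nat, (0 < k0)%N &
    forall k : nat, (k0 <= k)%N ->
      (chi (square (kneser (2 * k + 1) k)))%:R <= (2 + eps) * k%:R.
Proof.
move=> eps0.
have [t t1 tP] : exists2 t, (1 < t)%N & 6 / eps < ((2 ^ t).-1)%:R.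
  pose a := Num.trunc (6 / eps); exists (a + 2)%N; first by lia.
  have a6 : 6 / eps < a.+1%:R by apply: truncnS_gt.
  apply: lt_le_trans a6 _; rewrite ler_nat.
  by have := ltn_expl (a + 2) (isT : (1 < 2)%N); lia.
set N := (2 ^ t).-1 in tP.
have Nt : (2 ^ t = N.+1)%N by rewrite /N prednK // expn_gt0.
pose b := Num.trunc ((2 * N%:R + 3) * 2 / eps).
have bP : (2 * N%:R + 3) * 2 / eps < b.+1%:R by apply: truncnS_gt.
exists (b + 2)%N => [|k bk]; first by lia.
have k1 : (1 < k)%N by lia.
have := chi_square_kneser_pow2 t k t1 k1; rewrite -/N Nt -(ler_nat R).
move=> /le_trans; apply.
have kb : b.+1%:R <= k%:R :> R by rewrite ler_nat; lia.
have k1R : 1 <= k%:R :> R by rewrite ler1n; lia.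
have qN : ((2 * k + 1) %/ N)%:R * N%:R <= 2 * k%:R + 1 :> R.
  rewrite -natrM -natrM natr1 ler_nat.
  by have := leq_trunc_div (2 * k + 1) N; lia.
rewrite natrM natrD -natr1; move: qN bP tP.
set q := _%:R; set n := N%:R; set x := k%:R in kb k1R *.
rewrite !ltr_pdivrMr // => qN bP tP.
have q0 : 0 <= q by rewrite /q ler0n.
(* Here [q * n <= 2 * x + 1 <= 3 * x], while [6 < n * eps]. *)
have qe : q <= eps * x / 2.
  have n0 : 0 < n by nra.
  by rewrite -(ler_pM2r n0); nra.
nra.
Qed.

Theorem corollary2p8 (R : realType) :
  (forall eps : R, 0 < eps ->
     exists2 k0 : nat, (0 < k0)%N &
       forall k : nat, (k0 <= k)%N ->
         (chi (square (kneser (2 * k + 1) k)))%:R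
           <= (2 + eps) * (k%:R + Num.sqrt (2 * k + 1)%:R))
  /\
  (forall eps : R, 0 < eps ->
     (limn_esup (fun k : nat =>
        ((chi (square (kneser (2 * k + 1) k)))%:R / k%:R : R)%:E)
      <= (2 + eps)%:E)%E).
Proof.
split=> eps eps0; have [k0 k0_gt0 k0P] := chi_square_kneser_asymp R eps eps0.
  exists k0 => // k /k0P /le_trans; apply.
  by rewrite ler_wpM2l ?lerDl ?sqrtr_ge0 // addr_ge0 // ltW.
(* The limit superior is an infimum of suprema over neighbourhoods of infinity; the tail from [k0]
   on is one of them, and [k0 > 0] makes the division by [k] legitimate there. *)
apply: ge_ereal_inf; eexists.
  by exists [set k | (k0 <= k)%N]%classic => //; apply: nbhs_infty_ge.
apply: ge_ereal_sup => _ [k /= k0k <-]; rewrite lee_fin.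
by rewrite ler_pdivrMr ?ltr0n ?(leq_trans k0_gt0) // k0P.
Qed.
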